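(* Let $(\mathcal{X},d)$ be a Polish metric space and let $(X_N)_{N\in\mathbb{N}}$ be a Markov chain on $\mathcal{X}$ with transition kernel $(P_x)_{x\in\mathcal{X}}$, where $x\mapsto P_x$ is measurable and each $P_x$ has finite first moment. Assume there exists $\kappa>0$ such that $W_1(P_x,P_y)\le(1-\kappa)\,d(x,y)$ for all $x,y\in\mathcal{X}$, and let $\pi$ be the invariant probability measure. Let $T\ge1$, $T_0\ge0$ be integers and $\hat\pi(f):=\frac1T\sum_{k=T_0+1}^{T_0+T}f(X_k)$. Assume $\sup_{x\in\mathcal{X}}\sigma(x)^2/n_x<\infty$. Then for every Lipschitz $f:\mathcal{X}\to\mathbb{R}$ and every starting point $x\in\mathcal{X}$, \[ \operatorname{Var}_x\hat\pi(f)\le \begin{cases} \dfrac{\|f\|_{\mathrm{Lip}}^2}{\kappa T}\sup_{y\in\mathcal{X}}\dfrac{\sigma(y)^2}{n_y\kappa}, & \text{if } T_0=0,\\[2mm] \dfrac{\|f\|_{\mathrm{Lip}}^2}{\kappa T}\Big(1+\dfrac{1}{\kappa T}\Big)\sup_{y\in\mathcal{X}}\dfrac{\sigma(y)^2}{n_y\kappa}, & \text{otherwise.} \end{cases} \]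
   Context: $W_1$ is the $L^1$ Wasserstein distance (infimum over couplings of $\int d(x,y)\,\xi(dx,dy)$). $\operatorname{Var}_x$ is the variance for the chain started at $X_0=x$. The coarse diffusion constant is $\sigma(x)^2:=\frac12\iint d(y,z)^2P_x(dy)P_x(dz)$, and the local dimension is $n_x:=\inf\{\iint d(y,z)^2P_x(dy)P_x(dz)\,/\,\iint|f(y)-f(z)|^2P_x(dy)P_x(dz)\ :\ f:\mathcal{X}\to\mathbb{R}\ 1\text{-Lipschitz}\}$ ($\ge1$). $\|f\|_{\mathrm{Lip}}:=\sup_{x\ne y}|f(x)-f(y)|/d(x,y)$. *)

(* Defs.v *)
From HB Require Import structures.
From mathcomp Require Import all_boot all_order all_algebra.
From mathcomp Require Import all_classical all_reals all_analysis measurable_realfun.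
Set Implicit Arguments. Unset Strict Implicit. Unset Printing Implicit Defensive.
Import Order.TTheory GRing.Theory Num.Theory.
Local Open Scope classical_set_scope.
Local Open Scope ring_scope.

Section Defs.
Context {R : realType} {dX : measure_display} {X : measurableType dX}.
Variable dist : X -> X -> R.

Definition is_metric : Prop :=
  [/\ forall x, dist x x = 0,
      forall x y, dist x y = 0 -> x = y,
      forall x y, dist x y = dist y x &
      forall x y z, dist x z <= dist x y + dist y z].

Definition metric_complete : Prop :=
  forall u : nat -> X,
    (forall e, 0 < e -> exists N, forall m n, (N <= m)%N -> (N <= n)%N -> dist (u m) (u n) < e) ->
    exists l, forall e, 0 < e -> exists N, forall n, (N <= n)%N -> dist (u n) l < e.

Definition metric_separable : Prop :=
  exists D : set X, countable D /\
    forall x e, 0 < e -> exists2 y, D y & dist x y < e.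

Definition open_balls : set (set X) :=
  [set B | exists x r, B = [set y | dist x y < r]].

(* the sigma-algebra of X is the Borel sigma-algebra of the metric (for a separable
   metric space it is generated by the open balls) *)
Definition borel_of_metric : Prop := (@measurable _ X) = <<s open_balls >>.

Definition polish_metric : Prop :=
  [/\ is_metric, metric_complete, metric_separable & borel_of_metric].

Definition is_coupling (mu nu : probability X R) (xi : probability (X * X)%type R) : Prop :=
  forall A, measurable A -> xi (A `*` setT) = mu A /\ xi (setT `*` A) = nu A.

Definition W1 (mu nu : probability X R) : \bar R :=
  ereal_inf [set r | exists xi, is_coupling mu nu xi /\
                       r = (\int[xi]_z (dist z.1 z.2)%:E)%E].

Definition lipschitz_fun (f : X -> R) : Prop :=
  exists L : R, forall y z, `|f y - f z| <= L * dist y z.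

Definition one_lipschitz (f : X -> R) : Prop :=
  forall y z, `|f y - f z| <= dist y z.

(* ||f||_Lip = sup_{y <> z} |f y - f z| / d(y,z)  (0 if X has at most one point) *)
Definition lipnorm (f : X -> R) : R :=
  fine (ereal_sup [set r | exists y z, y <> z /\ r = (`|f y - f z| / dist y z)%:E]).

Variable P : X -> probability X R.

Definition sqdist_int (x : X) : \bar R :=
  (\int[P x]_y \int[P x]_z ((dist y z) ^+ 2)%:E)%E.

Definition sqdiff_int (x : X) (f : X -> R) : \bar R :=
  (\int[P x]_y \int[P x]_z ((`|f y - f z|) ^+ 2)%:E)%E.

Definition sigma2 (x : X) : \bar R := ((2^-1)%:E * sqdist_int x)%E.

(* n_x = inf over 1-Lipschitz f of (\iint d^2) / (\iint |f y - f z|^2);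
   f with vanishing denominator contribute +oo (hence are omitted) *)
Definition local_dim (x : X) : \bar R :=
  ereal_inf [set r | exists f, one_lipschitz f /\
      (0 < sqdiff_int x f < +oo)%E /\ r = (sqdist_int x * ((fine (sqdiff_int x f))^-1)%:E)%E].

Definition diff_ratio (x : X) : \bar R :=
  match sigma2 x with
  | r%:E => match local_dim x with n%:E => (r / n)%:E | _ => 0%E end
  | _ => +oo%E
  end.

Definition scons (x : X) (w : nat -> X) : nat -> X :=
  fun k => if k is k'.+1 then w k' else x.

(* pathE n x G = E_x[ G(X_0, X_1, ...) ] for G depending only on X_0, ..., X_n,
   where X_0 = x and X_{k+1} ~ P_{X_k} (Ionescu-Tulcea finite-dimensional laws). *)
Fixpoint pathE (n : nat) (x : X) (G : (nat -> X) -> \bar R) : \bar R :=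
  match n with
  | 0 => G (fun _ => x)
  | n'.+1 => (\int[P x]_y pathE n' y (fun w => G (scons x w)))%E
  end.

Definition emp_mean (T T0 : nat) (f : X -> R) (w : nat -> X) : R :=
  (T%:R)^-1 * \sum_(T0.+1 <= k < (T0 + T).+1) f (w k).

Definition emp_mean_exp (T T0 : nat) (f : X -> R) (x : X) : R :=
  fine (pathE (T0 + T) x (fun w => (emp_mean T T0 f w)%:E)).

Definition emp_mean_var (T T0 : nat) (f : X -> R) (x : X) : \bar R :=
  pathE (T0 + T) x (fun w => ((emp_mean T T0 f w - emp_mean_exp T T0 f x) ^+ 2)%:E).

End Defs.

(* Main.v *)
Require Import Defs.
From mathcomp Require Import all_boot all_order all_algebra.
From mathcomp Require Import all_classical all_reals all_analysis measurable_realfun.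
From mathcomp Require Import ring lra.
Set Implicit Arguments. Unset Strict Implicit. Unset Printing Implicit Defensive.
Import Order.TTheory GRing.Theory Num.Theory.
Local Open Scope classical_set_scope.
Local Open Scope ring_scope.

(** Expanding the expectation one step at a time,
      E_x (a + sum_{k<=n} h_k(X_k))^2 <= (a + E_x sum_{k<=n} h_k(X_k))^2 + V s,
    where s bounds sigma(y)^2 / n_y and V is the sum of the squared Lipschitz constants
    of the conditional expectations of the remaining sums.  Each step costs the variance
    under P_x of an L-Lipschitz function, which is half its double integral
    of squared differences, hence at most L^2 s by definition of n_x; and W_1-contraction
    makes P shrink Lipschitz constants by c = 1 - kappa.  For the weights 1/T on
    T0 < k <= T0 + T, each of the last T steps contributes at most
    (||f||_Lip / (kappa T))^2, and the earlier ones contribute geometrically less. *)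

(** * Measurability and integrability of Lipschitz functions *)

(** A nonnegative integral is a supremum over simple functions below the integrand, and a larger
    integrand admits more of them. This serves where measurability is not at hand: the distance
    under a coupling, the nested path expectations. *)
Lemma ge0_le_integral_nonmeasurable d (T : measurableType d) (R : realType)
    (mu : {measure set T -> \bar R}) (D : set T) (f g : T -> \bar R) :
  (forall t, D t -> (0 <= f t)%E) -> (forall t, D t -> (f t <= g t)%E) ->
  (\int[mu]_(t in D) f t <= \int[mu]_(t in D) g t)%E.
Proof.
move=> f0 fg.
have g0 t : D t -> (0 <= g t)%E by move=> Dt; exact: le_trans (f0 _ Dt) (fg _ Dt).
rewrite !ge0_integralE//; apply: ge_ereal_sup => _ [h /= hf <-].
apply: ereal_sup_ubound; exists h => // t; apply: le_trans (hf t) _.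
by rewrite !patchE; case: ifPn => //; rewrite inE => /fg.
Qed.

Lemma is_metric_ge0 (R : realType) (dX : measure_display) (X : measurableType dX)
    (dist : X -> X -> R) (x y : X) : is_metric dist -> 0 <= dist x y.
Proof. by move=> [d0 _ dC dT]; have := dT x y x; rewrite d0 (dC y x); lra. Qed.

(** Sublevel sets are open, hence countable unions of balls centred in the dense set, and balls
    generate the sigma-algebra. *)
Lemma lipschitz_measurable (R : realType) (dX : measure_display)
    (X : measurableType dX) (dist : X -> X -> R) (g : X -> R) :
  polish_metric dist -> lipschitz_fun dist g -> measurable_fun setT g.
Proof.
move=> polish [L gL].
have dist_ge0 a b : 0 <= dist a b by case: polish => metric _ _ _; exact: is_metric_ge0.
move: polish => [[_ _ dC dT] _ [D [/countable_injP[e einj] Ddense]] borel].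
have mball x r : measurable [set y | dist x y < r].
  by rewrite borel; apply: sub_sigma_algebra; exists x, r.
apply: (measurability _ (RGenInftyO.measurableE R)).
move=> _ [_ [r ->] <-]; rewrite setTI.
pose U := g @^-1` `]-oo, r[; rewrite -/U.
(* The ball of radius 1/(n+1) around the point of [D] coded by [k] if it lies in [U], else empty;
   the codes make the union countable. *)
pose F k n := [set y | exists2 c, [/\ D c, e c = k &
   [set z | dist c z < n.+1%:R^-1] `<=` U] & dist c y < n.+1%:R^-1].
have -> : U = \bigcup_k \bigcup_n F k n.
  apply/seteqP; split=> [y|y [k _ [n _ [c [_ _ cU]]]]]; last exact: cU.
  rewrite /U /= in_itv /= => yr.
  (* [L] may be nonpositive; [M] is a Lipschitz constant fit for division. *)
  pose M := Num.max L 0 + 1.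
  have M0 : 0 < M by rewrite ltr_wpDl // le_max lexx orbT.
  have gM a b : `|g a - g b| <= M * dist a b.
    apply: le_trans (gL a b) _.
    apply: ler_wpM2r => //; rewrite /M; have : L <= Num.max L 0 by rewrite le_max lexx.
    lra.
  (* Half of (r - g y) / M, because the radius is spent twice: from [y] to [c] and from [c] to
     [z]. *)
  have e0 : 0 < (r - g y) / (2 * M) by rewrite divr_gt0 ?mulr_gt0// subr_gt0.
  have [n ne] : exists n : nat, n.+1%:R^-1 < (r - g y) / (2 * M).
    have [n _ /(_ n (leqnn n)) ne] := near_infty_natSinv_lt (PosNum e0).
    by exists n.
  have n0 : 0 < n.+1%:R^-1 :> R by rewrite invr_gt0.
  have [c Dc yc] := Ddense y _ n0.
  exists (e c) => //; exists n => //; exists c; last by rewrite dC.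
  split => // z /= cz; rewrite /U /= in_itv /=.
  have yz : dist y z < (r - g y) / M.
    have -> : (r - g y) / M = (r - g y) / (2 * M) + (r - g y) / (2 * M).
      by field; rewrite gt_eqF.
    have := dT y c z; move: (dist y z) (dist y c) (dist c z) ne yc cz => u v w.
    move: (_ / _) (_^-1) => p q; lra.
  have := gM y z; rewrite ltr_pdivlMr // mulrC in yz.
  by rewrite ler_norml => /andP[+ _]; lra.
apply: bigcupT_measurable => k; apply: bigcupT_measurable => n.
have [[c [Dc ck cU]]|nc] := pselect (exists c, [/\ D c, e c = k &
   [set z | dist c z < n.+1%:R^-1] `<=` U]).
  rewrite (_ : F k n = [set y | dist c y < n.+1%:R^-1])//.
  apply/seteqP; split=> [y [c' [Dc' c'k _]]|y cy]; last by exists c.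
  by rewrite (einj c' c) ?inE// c'k.
rewrite (_ : F k n = set0)//; apply/seteqP; split=> // y [c hc _].
by apply: nc; exists c.
Qed.

Lemma integral_cst_probability d (T : measurableType d) (R : realType)
    (mu : probability T R) (c : \bar R) : (\int[mu]_y c = c)%E.
Proof.
rewrite integral_cst //.
by transitivity (c * 1)%E; [congr (_ * _)%E; exact: probability_setT|rewrite mule1].
Qed.

Lemma lipschitz_integrable (R : realType) (dX : measure_display)
    (X : measurableType dX) (dist : X -> X -> R) (mu : probability X R) (x : X)
    (g : X -> R) :
  polish_metric dist -> mu.-integrable setT (fun y => (dist x y)%:E) ->
  lipschitz_fun dist g -> mu.-integrable setT (EFin \o g).
Proof.
move=> polish idist lipg; have mg := lipschitz_measurable polish lipg.
case: lipg => L gL.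
apply: (@le_integrable _ _ _ _ _ measurableT _
    (fun y => (`|g x|%:E + L%:E * (dist x y)%:E)%E)).
- exact/measurable_EFinP.
- move=> y _; rewrite -EFinM -EFinD lee_fin.
  apply: le_trans (ler_norm _); have := gL x y.
  by have := ler_normB (g x) (g x - g y); rewrite opprB addrC subrK; lra.
- apply: integrableD => //; last exact: integrableZl.
  exact: finite_measure_integrable_cst.
Qed.

(** * Couplings and Lipschitz test functions *)

Lemma integral_image (R : realType) (dX dY : measure_display)
    (X : measurableType dX) (Y : measurableType dY)
    (mu : probability X R) (nu : probability Y R) (phi : Y -> X) (g : X -> R) :
  measurable_fun setT phi ->
  (forall A, measurable A -> nu (phi @^-1` A) = mu A) ->
  mu.-integrable setT (EFin \o g) ->
  nu.-integrable setT (EFin \o (g \o phi)) /\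
  \int[nu]_y g (phi y) = \int[mu]_x g x.
Proof.
move=> mphi numu ig; have /integrableP[mg gfin] := ig.
have push f : (\int[mu]_x f x = \int[pushforward nu phi]_x f x)%E.
  by apply: eq_measure_integral => A mA _; symmetry; exact: numu.
have inu : nu.-integrable setT (EFin \o (g \o phi)).
  apply/integrableP; split.
    by rewrite (_ : _ \o _ = (EFin \o g) \o phi)//; exact: measurableT_comp.
  rewrite push ge0_integral_pushforward // in gfin.
  exact: measurableT_comp.
split => //; rewrite /Rintegral push; congr fine.
by rewrite (integral_pushforward mphi).
Qed.

(** The easy half of Kantorovich duality: under a coupling the difference of means is the integral
    of [g z.1 - g z.2], at most [L] times the transport cost. *)
Lemma W1_lipschitz (R : realType) (dX : measure_display)
    (X : measurableType dX) (dist : X -> X -> R) (mu nu : probability X R)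
    (g : X -> R) (L C : R) :
  is_metric dist ->
  mu.-integrable setT (EFin \o g) -> nu.-integrable setT (EFin \o g) ->
  0 <= L -> (forall y z, `|g y - g z| <= L * dist y z) ->
  (W1 dist mu nu <= C%:E)%E ->
  `|\int[mu]_y g y - \int[nu]_y g y| <= L * C.
Proof.
move=> metric imu inu; rewrite le_eqVlt => /predU1P[<-|L0] gL muC.
  have gcst y z : g y = g z.
    by apply/eqP; rewrite -subr_eq0 -normr_le0; have := gL y z; rewrite mul0r.
  have cstE (m : probability X R) : \int[m]_y g y = g point.
    rewrite (_ : g = fun=> g point); last by apply/funext => y; exact: gcst.
    by rewrite /Rintegral integral_cst_probability.
  by rewrite mul0r !cstE subrr normr0.
rewrite -ler_pdivrMl //; apply/ler_addgt0Pr => e e0.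
have /ereal_inf_lt[_ [xi [xi12 ->]] xiC] : (W1 dist mu nu < (C + e)%:E)%E.
  by apply: le_lt_trans muC _; rewrite lte_fin ltrDl.
have [i1 E1] : xi.-integrable setT (EFin \o (g \o fst)) /\
    \int[xi]_z g z.1 = \int[mu]_y g y.
  apply: integral_image => // A mA; rewrite -(xi12 A mA).1.
  by congr (xi _); apply/seteqP; split=> z //= [].
have [i2 E2] : xi.-integrable setT (EFin \o (g \o snd)) /\
    \int[xi]_z g z.2 = \int[nu]_y g y.
  apply: integral_image => // A mA; rewrite -(xi12 A mA).2.
  by congr (xi _); apply/seteqP; split=> z //= [].
have i12 : xi.-integrable setT (EFin \o (fun z => g z.1 - g z.2)).
  exact: (integrableB measurableT i1 i2).
rewrite -E1 -E2 -(RintegralB measurableT i1 i2).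
apply: (@le_trans _ _ (L^-1 * \int[xi]_z `|g z.1 - g z.2|)).
  by rewrite ler_pM2l ?invr_gt0//; exact: le_normr_Rintegral.
have iabs := integrable_norm i12.
(* [L^-1] goes inside the integral, so that the comparison with [dist] is pointwise. *)
rewrite -(RintegralZl _ measurableT iabs) -lee_fin /Rintegral fineK; last first.
  by apply: integrable_fin_num => //; exact: (integrableZl _ _ iabs).
apply: le_trans (ltW xiC); apply: ge0_le_integral_nonmeasurable => z _.
  by rewrite lee_fin; apply: mulr_ge0; [rewrite invr_ge0 ltW|exact: normr_ge0].
by rewrite lee_fin ler_pdivrMl ?gL.
Qed.

(** * Variance as a double integral *)

Lemma EFin_Rintegral d (T : measurableType d) (R : realType)
    (mu : {measure set T -> \bar R}) (f : T -> R) :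
  mu.-integrable setT (EFin \o f) ->
  (\int[mu]_x (f x)%:E)%E = (\int[mu]_x f x)%:E.
Proof. by move=> fi; rewrite /Rintegral fineK //; exact: integrable_fin_num. Qed.

Lemma integral_sqrD (R : realType) d (T : measurableType d) (mu : probability T R)
    (g : T -> R) (a b : R) :
  mu.-integrable setT (EFin \o g) ->
  mu.-integrable setT (EFin \o (fun y => g y ^+ 2)) ->
  (\int[mu]_y ((a + g y) ^+ 2 + b)%:E)%E =
  (a ^+ 2 + 2 * a * \int[mu]_y g y + \int[mu]_y g y ^+ 2 + b)%:E.
Proof.
move=> ig ig2.
transitivity (\int[mu]_y ((a ^+ 2 + b)%:E + ((2 * a)%:E * (g y)%:E + (g y ^+ 2)%:E)))%E.
  by apply: eq_integral => y _; rewrite -EFinM -!EFinD; congr EFin; ring.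
have i1 := integrableZl measurableT (2 * a) ig.
have i2 := integrableD measurableT i1 ig2.
have i0 := finite_measure_integrable_cst mu (a ^+ 2 + b) measurableT.
rewrite (integralD measurableT i0 i2) (integralD measurableT i1 ig2).
rewrite (integralZl measurableT ig).
rewrite [X in (X + _)%E](integral_cst_probability mu (a ^+ 2 + b)%:E).
by rewrite !EFin_Rintegral // -EFinM -!EFinD; congr EFin; ring.
Qed.

(** A finite double integral forces a finite inner integral at some y, and then g(z)^2 <= 2 g(y)^2 +
    2 |g(y) - g(z)|^2 dominates. *)
Lemma sqr_integrable_of_sqdiff (R : realType) d (T : measurableType d)
    (mu : probability T R) (g : T -> R) :
  measurable_fun setT g ->
  (\int[mu]_y \int[mu]_z (`|g y - g z| ^+ 2)%:E < +oo)%E ->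
  mu.-integrable setT (EFin \o (fun y => g y ^+ 2)).
Proof.
move=> mg fin.
have [y yfin] : exists y, (\int[mu]_z (`|g y - g z| ^+ 2)%:E < +oo)%E.
  apply: contrapT => /forallNP inf; move: fin.
  rewrite (_ : (fun y => _) = fun=> +oo%E); last first.
    by apply/funext => y; have /negP := inf y; rewrite ltey negbK => /eqP.
  by rewrite integral_cst_probability ltxx.
have iy : mu.-integrable setT (EFin \o (fun z => `|g y - g z| ^+ 2)).
  apply/integrableP; split.
    apply/measurable_EFinP; apply: measurable_funX.
    by apply: measurableT_comp => //; exact: measurable_funB.
  rewrite (eq_integral (fun z => (`|g y - g z| ^+ 2)%:E)) // => z _.
  by rewrite /= ger0_norm // exprn_ge0.
apply: (@le_integrable _ _ _ _ _ measurableT _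
    (fun z => ((2 * g y ^+ 2)%:E + 2%:E * (`|g y - g z| ^+ 2)%:E)%E)).
- by apply/measurable_EFinP; exact: measurable_funX.
- move=> z _; rewrite -EFinM -EFinD lee_fin real_normK ?num_real //.
  rewrite ger0_norm ?sqr_ge0 //; apply: le_trans (ler_norm _).
  rewrite -subr_ge0 (_ : _ - _ = (2 * g y - g z) ^+ 2) ?sqr_ge0 //; ring.
- apply: integrableD => //; last exact: integrableZl.
  exact: finite_measure_integrable_cst.
Qed.

(** With m and q the first two moments, the inner integral at y is (g(y) - m)^2 + (q - m^2), so the
    double integral is twice the variance. *)
Lemma variance_le_sqdiff (R : realType) d (T : measurableType d)
    (mu : probability T R) (g : T -> R) (v : R) :
  mu.-integrable setT (EFin \o g) ->
  (\int[mu]_y \int[mu]_z (`|g y - g z| ^+ 2)%:E <= (2 * v)%:E)%E ->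
  mu.-integrable setT (EFin \o (fun y => g y ^+ 2)) /\
  \int[mu]_y g y ^+ 2 <= (\int[mu]_y g y) ^+ 2 + v.
Proof.
move=> ig D.
have mg : measurable_fun setT g by apply/measurable_EFinP; case/integrableP: ig.
have ig2 := sqr_integrable_of_sqdiff mg (le_lt_trans D (ltry _)).
split => //; move: D.
set m := (\int[mu]_y g y); set q := (\int[mu]_y g y ^+ 2).
have -> : (fun y => \int[mu]_z (`|g y - g z| ^+ 2)%:E)%E =
    (fun y => ((- m + g y) ^+ 2 + (q - m ^+ 2))%:E).
  apply/funext => y.
  transitivity (\int[mu]_z ((- g y + g z) ^+ 2 + 0)%:E)%E.
    apply: eq_integral => z _; congr EFin.
    by rewrite real_normK ?num_real //; ring.
  by rewrite integral_sqrD //; congr EFin; rewrite -/m -/q; ring.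
rewrite integral_sqrD // lee_fin -/m -/q.
have -> : (- m) ^+ 2 + 2 * - m * m + q + (q - m ^+ 2) = 2 * (q - m ^+ 2) by ring.
by rewrite ler_pM2l // lerBlDl.
Qed.

(** * Local dimension and the variance of one transition *)

Section diff_ratio.
Context {R : realType} {dX : measure_display} {X : measurableType dX}.
Context {dist : X -> X -> R} {P : X -> probability X R}.
Implicit Types (x : X) (g : X -> R).

Lemma sqdiff_int_ge0 x g : (0 <= sqdiff_int P x g)%E.
Proof.
by apply: integral_ge0 => y _; apply: integral_ge0 => z _; rewrite lee_fin exprn_ge0.
Qed.

Lemma sqdist_int_ge0 x : (0 <= sqdist_int dist P x)%E.
Proof.
by apply: integral_ge0 => y _; apply: integral_ge0 => z _; rewrite lee_fin sqr_ge0.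
Qed.

Lemma sqdiff_int_le_sqdist_int x g :
  one_lipschitz dist g -> (sqdiff_int P x g <= sqdist_int dist P x)%E.
Proof.
move=> g1; apply: ge0_le_integral_nonmeasurable => y _.
  by apply: integral_ge0 => z _; rewrite lee_fin exprn_ge0.
apply: ge0_le_integral_nonmeasurable => z _; rewrite lee_fin ?exprn_ge0 //.
by apply: lerXn2r; rewrite ?nnegrE ?(le_trans _ (g1 y z)).
Qed.

Lemma local_dim_ge1 x : (1 <= local_dim dist P x)%E.
Proof.
apply: le_ereal_inf_tmp => _ [g [g1 [/andP[D0 Dy] ->]]]; move: D0 Dy.
have := sqdiff_int_le_sqdist_int x g1; have := sqdist_int_ge0 x.
case: (sqdiff_int P x g) => [D||] //; case: (sqdist_int dist P x) => [S||] //=.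
- rewrite !lee_fin lte_fin => S0 DS D0 _.
  by rewrite ler_pdivlMr // mul1r.
- by rewrite lte_fin => _ _ D0 _; rewrite gt0_mulye ?leey // lte_fin invr_gt0.
Qed.

Lemma diff_ratio_ge0 x : (0 <= diff_ratio dist P x)%E.
Proof.
rewrite /diff_ratio /sigma2; have := sqdist_int_ge0 x; have := local_dim_ge1 x.
case: (sqdist_int dist P x) => [S||] //=; last first.
  by rewrite gt0_muley // lte_fin invr_gt0.
case: (local_dim dist P x) => [n||] //=; rewrite !lee_fin => n1 S0.
by rewrite divr_ge0 ?mulr_ge0 ?(le_trans _ n1).
Qed.

(** As [g] competes in the infimum, n_x is at most [sqdist_int] over [sqdiff_int]; solving for the
    denominator bounds it by 2 sigma^2 / n_x. *)
Lemma sqdiff_int_le_diff_ratio x g (s : R) : one_lipschitz dist g ->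
  (diff_ratio dist P x <= s%:E)%E -> (sqdiff_int P x g <= (2 * s)%:E)%E.
Proof.
move=> g1 xs; have s0 := le_trans (diff_ratio_ge0 x) xs; move: xs.
have := sqdiff_int_le_sqdist_int x g1; rewrite lee_fin in s0.
rewrite /diff_ratio /sigma2; have := local_dim_ge1 x.
have : (0 < sqdiff_int P x g < +oo)%E -> (local_dim dist P x <=
    sqdist_int dist P x * ((fine (sqdiff_int P x g))^-1)%:E)%E.
  by move=> Dfin; apply: ereal_inf_lbound; exists g.
have := sqdist_int_ge0 x; have := sqdiff_int_ge0 x g.
(* An infinite [sqdist_int] makes [diff_ratio] infinite, against the bound [s]. *)
case: (sqdist_int dist P x) => [S||] //=; last first.
  by rewrite gt0_muley // lte_fin invr_gt0.
case: (sqdiff_int P x g) => [D||] //=.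
rewrite !lee_fin lte_fin ltry andbT le_eqVlt => /predU1P[<- *|D0].
  by rewrite mulr_ge0.
(* Here [g] does compete, so [local_dim] is finite and the default value 0 of [diff_ratio] does not
   occur. *)
move=> S0 /(_ D0); case: (local_dim dist P x) => [n||] //=.
rewrite !lee_fin => nSD n1 DS; have n0 : 0 < n by apply: lt_le_trans n1.
rewrite ler_pdivrMr // => Ss; rewrite ler_pdivlMr // in nSD.
rewrite -(ler_pM2l n0); apply: le_trans nSD _; rewrite mulrCA; lra.
Qed.

(** Dividing by [L] gives a 1-Lipschitz function, and variance scales by L^2; for L = 0 the function
    is constant. *)
Lemma variance_le_lipschitz x g (L s : R) : 0 <= L ->
  (P x).-integrable setT (EFin \o g) ->
  (forall y z, `|g y - g z| <= L * dist y z) -> (diff_ratio dist P x <= s%:E)%E ->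
  (P x).-integrable setT (EFin \o (fun y => g y ^+ 2)) /\
  \int[P x]_y g y ^+ 2 <= (\int[P x]_y g y) ^+ 2 + L ^+ 2 * s.
Proof.
rewrite le_eqVlt => /predU1P[<- ig gL xs|L0 ig gL xs].
  apply: variance_le_sqdiff => //; rewrite expr0n mul0r mulr0 integral0_eq // => y _.
  apply: integral0_eq => z _; have := gL y z; rewrite mul0r normr_le0 => /eqP ->.
  by rewrite normr0 expr0n.
pose g1 y := L^-1 * g y.
have g1lip : one_lipschitz dist g1.
  by move=> y z; rewrite -mulrBr normrM gtr0_norm ?invr_gt0 // ler_pdivrMl.
have ig1 : (P x).-integrable setT (EFin \o g1) := integrableZl measurableT L^-1 ig.
have [ig12 var1] := variance_le_sqdiff ig1 (sqdiff_int_le_diff_ratio g1lip xs).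
have gE : g = (fun y => L * g1 y).
  by apply/funext => y; rewrite /g1 mulVKf // gt_eqF.
have g2E : (fun y => g y ^+ 2) = (fun y => L ^+ 2 * g1 y ^+ 2).
  by apply/funext => y; rewrite gE exprMn.
split; first by rewrite g2E; exact: (integrableZl measurableT (L ^+ 2) ig12).
have -> : \int[P x]_y g y ^+ 2 = L ^+ 2 * \int[P x]_y g1 y ^+ 2.
  by rewrite g2E RintegralZl.
have -> : \int[P x]_y g y = L * \int[P x]_y g1 y by rewrite {1}gE RintegralZl.
by rewrite exprMn -mulrDr ler_pM2l // exprn_gt0.
Qed.

(** The inductive step of the variance bound: [a] collects the terms already observed, [b] the
    variance of the steps to come. *)
Lemma integral_sqrD_le x g (L s a b : R) : 0 <= L ->
  (P x).-integrable setT (EFin \o g) ->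
  (forall y z, `|g y - g z| <= L * dist y z) -> (diff_ratio dist P x <= s%:E)%E ->
  (\int[P x]_y ((a + g y) ^+ 2 + b)%:E <=
    ((a + \int[P x]_y g y) ^+ 2 + L ^+ 2 * s + b)%:E)%E.
Proof.
move=> L0 ig gL xs; have [ig2 var] := variance_le_lipschitz L0 ig gL xs.
by rewrite integral_sqrD // lee_fin sqrrD -mulr_natl; lra.
Qed.

End diff_ratio.

(** * Mean and second moment of sums along the chain *)

Section markov_chain.
Context {R : realType} {dX : measure_display} {X : measurableType dX}.
Context {dist : X -> X -> R} {P : X -> probability X R}.
Implicit Types (n : nat) (h : nat -> X -> R) (l : nat -> R) (c s : R) (x : X).

(* chain_exp n h x = E_x[h_0(X_0) + ... + h_n(X_n)] *)
Fixpoint chain_exp n h x : R :=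
  if n is n'.+1 then h 0%N x + \int[P x]_y chain_exp n' (fun k => h k.+1) y
  else h 0%N x.

(* If h_k is l_k-Lipschitz and P contracts Lipschitz constants by c, then
   chain_exp n h is (chain_lip c n l)-Lipschitz. *)
Fixpoint chain_lip c n l : R :=
  if n is n'.+1 then l 0%N + c * chain_lip c n' (fun k => l k.+1) else l 0%N.

(** X_0 is deterministic, so variance is counted from the first transition on: each one adds the
    squared Lipschitz constant of the expected remaining sum. *)
Fixpoint chain_var c n l : R :=
  if n is n'.+1 then
    chain_lip c n' (fun k => l k.+1) ^+ 2 + chain_var c n' (fun k => l k.+1)
  else 0.

Lemma chain_lip_ge0 c n l : 0 <= c -> (forall k, 0 <= l k) -> 0 <= chain_lip c n l.
Proof. by move=> c0; elim: n l => [|n IH] l l0 //=; rewrite addr_ge0 ?mulr_ge0 ?IH. Qed.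

Hypothesis polish : polish_metric dist.
Hypothesis first_moment : forall x, (P x).-integrable setT (fun y => (dist x y)%:E).

Let is_metric_dist : is_metric dist. Proof. by case: polish. Qed.

(** The tail expectation is Lipschitz by induction, and the contraction with [W1_lipschitz] turns
    its constant into [c] times it. *)
Lemma chain_exp_lipschitz c n h l : 0 <= c ->
  (forall x y, (W1 dist (P x) (P y) <= (c * dist x y)%:E)%E) ->
  (forall k, 0 <= l k) -> (forall k y z, `|h k y - h k z| <= l k * dist y z) ->
  forall y z, `|chain_exp n h y - chain_exp n h z| <= chain_lip c n l * dist y z.
Proof.
move=> c0 contr; elim: n h l => [|n IH] h l l0 hl y z /=; first exact: hl.
have IHS := IH (fun k => h k.+1) (fun k => l k.+1) (fun k => l0 k.+1) (fun k => hl k.+1).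
have lip : lipschitz_fun dist (chain_exp n (fun k => h k.+1)) by eexists; exact: IHS.
have := W1_lipschitz is_metric_dist (lipschitz_integrable polish (first_moment y) lip)
  (lipschitz_integrable polish (first_moment z) lip)
  (chain_lip_ge0 n c0 (fun k => l0 k.+1)) IHS (contr y z).
set A := \int[P y]_y _; set B := \int[P z]_y _ => AB.
rewrite (_ : _ - _ = (h 0%N y - h 0%N z) + (A - B)); last by ring.
apply: le_trans (ler_normD _ _) _; rewrite mulrDl; apply: lerD; first exact: hl.
by rewrite -mulrA mulrCA.
Qed.

(** h_0(x) is constant under the next transition and moves into [a]; the Lipschitz bounds make the
    tail integrable. *)
Lemma pathE_sum c n h l a x : 0 <= c ->
  (forall x y, (W1 dist (P x) (P y) <= (c * dist x y)%:E)%E) ->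
  (forall k, 0 <= l k) -> (forall k y z, `|h k y - h k z| <= l k * dist y z) ->
  pathE P n x (fun w => (a + \sum_(0 <= k < n.+1) h k (w k))%:E) =
  (a + chain_exp n h x)%:E.
Proof.
move=> c0 contr; elim: n h l a x => [|n IH] h l a x l0 hl /=.
  by rewrite big_nat1.
have l0S k : 0 <= l k.+1 by [].
have hlS k : forall y z, `|h k.+1 y - h k.+1 z| <= l k.+1 * dist y z by [].
pose g := chain_exp n (fun k => h k.+1).
have ig : (P x).-integrable setT (EFin \o g).
  apply: lipschitz_integrable polish (first_moment x) _; eexists.
  exact: (chain_exp_lipschitz n c0 contr l0S hlS).
transitivity (\int[P x]_y ((a + h 0%N x)%:E + (g y)%:E))%E.
  apply: eq_integral => y _; rewrite -EFinD -(IH _ _ _ _ l0S hlS).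
  congr pathE; apply/funext => w; congr EFin.
  by rewrite big_nat_recl //= addrA.
have i0 := finite_measure_integrable_cst (P x) (a + h 0%N x) measurableT.
rewrite (integralD measurableT i0 ig).
rewrite [X in (X + _)%E](integral_cst_probability (P x) (a + h 0%N x)%:E).
by rewrite EFin_Rintegral // -EFinD addrA.
Qed.

Lemma pathE_ge0 n x (G : (nat -> X) -> \bar R) :
  (forall w, (0 <= G w)%E) -> (0 <= pathE P n x G)%E.
Proof. by elim: n x G => [|n IH] x G G0 //=; apply: integral_ge0 => y _; exact: IH. Qed.

(** The induction hypothesis is used at each next state with h_0(x) added to [a]; integrating over
    that state is then [integral_sqrD_le]. *)
Lemma pathE_sqr_sum_le c n h l s a x : 0 <= c ->
  (forall x y, (W1 dist (P x) (P y) <= (c * dist x y)%:E)%E) ->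
  (forall x, (diff_ratio dist P x <= s%:E)%E) ->
  (forall k, 0 <= l k) -> (forall k y z, `|h k y - h k z| <= l k * dist y z) ->
  (pathE P n x (fun w => ((a + \sum_(0 <= k < n.+1) h k (w k)) ^+ 2)%:E) <=
   ((a + chain_exp n h x) ^+ 2 + chain_var c n l * s)%:E)%E.
Proof.
move=> c0 contr ratio; elim: n h l a x => [|n IH] h l a x l0 hl /=.
  by rewrite big_nat1 mul0r addr0.
have l0S k : 0 <= l k.+1 by [].
have hlS k : forall y z, `|h k.+1 y - h k.+1 z| <= l k.+1 * dist y z by [].
pose g := chain_exp n (fun k => h k.+1).
have gL := chain_exp_lipschitz n c0 contr l0S hlS.
have ig : (P x).-integrable setT (EFin \o g).
  by apply: lipschitz_integrable polish (first_moment x) _; eexists; exact: gL.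
pose v := chain_var c n (fun k => l k.+1).
apply: (@le_trans _ _ (\int[P x]_y ((a + h 0%N x + g y) ^+ 2 + v * s)%:E)%E).
  (* pathE P n y _ is not known to be measurable in y. *)
  apply: ge0_le_integral_nonmeasurable => y _.
    by apply: pathE_ge0 => w; rewrite lee_fin sqr_ge0.
  apply: le_trans (IH _ _ _ _ l0S hlS).
  rewrite le_eqVlt; apply/orP; left; apply/eqP; congr pathE; apply/funext => w.
  by rewrite big_nat_recl //= addrA.
apply: le_trans (integral_sqrD_le _ _ (chain_lip_ge0 n c0 l0S) ig gL (ratio x)) _.
by rewrite lee_fin mulrDl !addrA.
Qed.

End markov_chain.

(** * Geometric bounds for constant and delayed weights *)

Section weights.
Context {R : realType} {c M : R}.
Hypothesis c01 : 0 <= c < 1.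
Hypothesis M0 : 0 <= M.

(** The geometric sum M + c M + c^2 M + ..., fixed by u -> M + c u. *)
Let A := M / (1 - c).

Let c0 : 0 <= c. Proof. by case/andP: c01. Qed.

Let c1 : 0 < 1 - c. Proof. by rewrite subr_gt0; case/andP: c01. Qed.

Let A0 : 0 <= A. Proof. by rewrite divr_ge0 // ltW. Qed.

Let AE : M + c * A = A. Proof. by rewrite /A; field; rewrite gt_eqF. Qed.

Lemma chain_lip_const n : chain_lip c n (fun=> M) <= A.
Proof.
elim: n => [|n IH] /=; first by rewrite -[leRHS]AE lerDl mulr_ge0.
by rewrite -[leRHS]AE lerD2l ler_wpM2l.
Qed.

Lemma chain_var_const n : chain_var c n (fun=> M) <= n%:R * A ^+ 2.
Proof.
elim: n => [|n IH] /=; first by rewrite mul0r.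
rewrite -natr1 mulrDl mul1r addrC; apply: lerD => //.
by apply: lerXn2r; rewrite ?nnegrE ?chain_lip_const ?chain_lip_ge0.
Qed.

(** The weights vanish up to time m, so the first m + 1 levels of the recursion only multiply by
    [c]. *)
Lemma chain_lip_delay m n :
  chain_lip c (m + n.+1) (fun k => if (m < k)%N then M else 0) <= c ^+ m.+1 * A.
Proof.
elim: m => [|m IH] /=.
  by rewrite add0r expr1 ler_wpM2l //; exact: chain_lip_const.
by rewrite add0r exprS -mulrA ler_wpM2l.
Qed.

(** The last n + 1 transitions cost at most A^2 each, the m before them at most (c^j A)^2 with 1 <=
    j <= m. The factor 1 - c^(2m) serves both cases of the theorem: it vanishes at m = 0 and never
    exceeds 1. *)
Lemma chain_var_delay m n :
  chain_var c (m + n.+1) (fun k => if (m < k)%N then M else 0) <=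
    (n.+1%:R + (1 - (c ^+ m) ^+ 2) / (1 - c)) * A ^+ 2.
Proof.
elim: m => [|m IH] /=.
  rewrite expr0 expr1n subrr mul0r addr0.
  (* Variance sees the weights from time 1 on, and for m = 0 these all equal [M]. *)
  exact: (chain_var_const n.+1).
apply: (@le_trans _ _ ((c ^+ m.+1 * A) ^+ 2 +
    (n.+1%:R + (1 - (c ^+ m) ^+ 2) / (1 - c)) * A ^+ 2)).
  apply: lerD; last exact: IH.
  apply: lerXn2r; last exact: chain_lip_delay.
    by rewrite nnegrE; apply: chain_lip_ge0 => // k; case: ifP.
  by rewrite nnegrE; apply: mulr_ge0 => //; exact: exprn_ge0.
rewrite exprMn -mulrDl ler_wpM2r ?sqr_ge0 // addrCA lerD2l (exprS c m) exprMn.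
(* In units of A^2 and with q = c^(2m), the bound grows by q (1 + c), at least the new term c^2
   q. *)
rewrite -subr_ge0 (_ : _ - _ = (c ^+ m) ^+ 2 * (1 + c - c ^+ 2)); last first.
  by field; rewrite gt_eqF.
by rewrite mulr_ge0 ?sqr_ge0 //; have := c0; have := c1; nra.
Qed.

End weights.

(** * The empirical mean and the Lipschitz norm *)

(** The empirical mean is a sum from time 0 with weight 0 up to [T0]. The rate [c] is kept apart
    from kappa so that c = 0 can be used when kappa > 1. *)
Lemma emp_mean_var_le (R : realType) (dX : measure_display) (X : measurableType dX)
    (dist : X -> X -> R) (P : X -> probability X R) (c s L : R) (T T0 : nat)
    (f : X -> R) (x : X) :
  polish_metric dist ->
  (forall x, (P x).-integrable setT (fun y => (dist x y)%:E)) ->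
  0 <= c < 1 ->
  (forall x y, (W1 dist (P x) (P y) <= (c * dist x y)%:E)%E) ->
  (forall x, (diff_ratio dist P x <= s%:E)%E) ->
  0 <= L -> (forall y z, `|f y - f z| <= L * dist y z) ->
  (emp_mean_var P T.+1 T0 f x <=
    ((T.+1%:R + (1 - (c ^+ T0) ^+ 2) / (1 - c)) *
     (T.+1%:R^-1 * L / (1 - c)) ^+ 2 * s)%:E)%E.
Proof.
move=> polish moment c01 contr ratio L0 fL.
have c0 : 0 <= c by case/andP: c01.
have s0 : 0 <= s by rewrite -lee_fin; exact: le_trans (diff_ratio_ge0 x) (ratio x).
pose h k y := if (T0 < k)%N then T.+1%:R^-1 * f y else 0.
pose l k := if (T0 < k)%N then T.+1%:R^-1 * L else 0.
have l0 k : 0 <= l k by rewrite /l; case: ifP; rewrite // mulr_ge0 ?invr_ge0.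
have hl k y z : `|h k y - h k z| <= l k * dist y z.
  rewrite /h /l; case: ifP => _; last by rewrite subrr normr0 mul0r.
  by rewrite -mulrBr normrM ger0_norm ?invr_ge0 // -mulrA ler_wpM2l ?invr_ge0.
have meanE w : emp_mean T.+1 T0 f w = 0 + \sum_(0 <= k < (T0 + T.+1).+1) h k (w k).
  rewrite add0r (@big_cat_nat _ _ _ T0.+1) //=; last by rewrite ltnS leq_addr.
  rewrite [X in X + _]big_nat big1 ?add0r; last first.
    by move=> k /andP[_]; rewrite /h ltnS leqNgt => /negbTE ->.
  rewrite /emp_mean mulr_sumr !big_nat; apply: eq_bigr => k /andP[T0k _].
  by rewrite /h T0k.
have expE : emp_mean_exp P T.+1 T0 f x = chain_exp (P := P) (T0 + T.+1) h x.
  rewrite /emp_mean_exp -[RHS]add0r -[RHS]/(fine (0 + _)%:E).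
  rewrite -(pathE_sum polish moment _ 0 x c0 contr l0 hl).
  by congr (fine (pathE _ _ _ _)); apply/funext => w; rewrite meanE.
rewrite /emp_mean_var expE; set e := chain_exp _ _ _.
(* Starting the accumulator at minus the mean cancels the squared term and leaves the variance. *)
apply: (@le_trans _ _ (((- e + e) ^+ 2 + chain_var c (T0 + T.+1) l * s)%:E)).
  apply: le_trans (pathE_sqr_sum_le polish moment _ (- e) x c0 contr ratio l0 hl).
  rewrite le_eqVlt; apply/orP; left; apply/eqP; congr pathE; apply/funext => w.
  by rewrite meanE add0r addrC.
rewrite lee_fin addNr expr0n /= add0r ler_wpM2r //.
by apply: chain_var_delay; rewrite // mulr_ge0 ?invr_ge0.
Qed.

Lemma lipnorm_ge0 (R : realType) (dX : measure_display) (X : measurableType dX)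
    (dist : X -> X -> R) (f : X -> R) : is_metric dist -> 0 <= lipnorm dist f.
Proof.
move=> metric; rewrite /lipnorm; set S := [set r | _].
(* On a one-point space the set is empty, and [fine] sends its supremum -oo to 0. *)
have [->|/set0P[r [y [z [yz _]]]]] := eqVneq S set0; first by rewrite ereal_sup0.
apply: fine_ge0; apply: (@le_trans _ _ (`|f y - f z| / dist y z)%:E).
  by rewrite lee_fin divr_ge0 // is_metric_ge0.
by apply: ereal_sup_ubound; exists y, z.
Qed.

(** Any Lipschitz constant of [f] bounds the supremum, which is then finite, so [fine] keeps its
    value. *)
Lemma lipschitz_fun_lipnorm (R : realType) (dX : measure_display)
    (X : measurableType dX) (dist : X -> X -> R) (f : X -> R) (y z : X) :
  is_metric dist -> lipschitz_fun dist f ->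
  `|f y - f z| <= lipnorm dist f * dist y z.
Proof.
move=> metric [L fL]; have [-> |/eqP yz] := eqVneq y z.
  by rewrite subrr normr0 mulr_ge0 ?lipnorm_ge0 ?is_metric_ge0.
have dist_gt0 u v : u <> v -> 0 < dist u v.
  move=> uv; rewrite lt_neqAle is_metric_ge0 // andbT eq_sym.
  by case: metric => _ d0 _ _; apply/eqP => /d0.
rewrite -ler_pdivrMr ?dist_gt0 // /lipnorm; set S := [set r | _].
have Sle : ((`|f y - f z| / dist y z)%:E <= ereal_sup S)%E.
  by apply: ereal_sup_ubound; exists y, z.
rewrite -lee_fin fineK // fin_real //; apply/andP; split.
  by apply: lt_le_trans Sle; exact: ltNyr.
apply: le_lt_trans (ltry L); apply: ge_ereal_sup => _ [u [v [uv ->]]].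
by rewrite lee_fin ler_pdivrMr ?dist_gt0.
Qed.

Theorem theorem2 (R : realType) (dX : measure_display) (X : measurableType dX)
  (dist : X -> X -> R) (P : X -> probability X R) (kappa : R) (T T0 : nat)
  (f : X -> R) (x : X) :
  polish_metric dist ->
  (forall A, measurable A -> measurable_fun [set: X] (P ^~ A)) ->
  (forall x : X, (P x).-integrable setT (fun y => (dist x y)%:E)) ->
  0 < kappa ->
  (forall x y : X, (W1 dist (P x) (P y) <= ((1 - kappa) * dist x y)%:E)%E) ->
  (1 <= T)%N ->
  (ereal_sup (range (diff_ratio dist P)) < +oo)%E ->
  lipschitz_fun dist f ->
  (emp_mean_var P T T0 f x <=
     (if T0 == 0%N then
        ((lipnorm dist f) ^+ 2 / (kappa * T%:R) / kappa)%:E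
      else
        ((lipnorm dist f) ^+ 2 / (kappa * T%:R) * (1 + (kappa * T%:R)^-1) / kappa)%:E)
     * ereal_sup (range (diff_ratio dist P)))%E.
Proof.
move=> polish _ moment kappa0 contr + supfin flip; case: T => // T _.
have metric : is_metric dist by case: polish.
have sup_ge y : (diff_ratio dist P y <= ereal_sup (range (diff_ratio dist P)))%E.
  by apply: ereal_sup_ubound; exists y.
have supE : ereal_sup (range (diff_ratio dist P)) =
    (fine (ereal_sup (range (diff_ratio dist P))))%:E.
  by rewrite fineK // ge0_fin_numE // (le_trans (diff_ratio_ge0 x) (sup_ge x)).
move: sup_ge supE; set s := fine _ => /[swap] ->; move=> ratio.
have s0 : 0 <= s by rewrite -lee_fin; exact: le_trans (diff_ratio_ge0 x) (ratio x).
have T0' : 0 < T.+1%:R :> R by rewrite ltr0n.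
have fL y z := lipschitz_fun_lipnorm y z metric flip.
have [kappa1|kappa1] := leP kappa 1; last first.
  (* A contraction with negative factor only exists on a one-point space. *)
  have dist0 y z : dist y z = 0.
    apply/eqP; rewrite eq_le is_metric_ge0 // andbT.
    have : (0 <= W1 dist (P y) (P z))%E.
      apply: le_ereal_inf_tmp => _ [xi [_ ->]]; apply: integral_ge0 => w _.
      by rewrite lee_fin is_metric_ge0.
    move=> /le_trans/(_ (contr y z)); rewrite lee_fin.
    by rewrite nmulr_rge0 // subr_lt0.
  have contr0 y z : (W1 dist (P y) (P z) <= (0 * dist y z)%:E)%E.
    by have := contr y z; rewrite dist0 !mulr0.
  have f0 y z : `|f y - f z| <= 0 * dist y z.
    by have := fL y z; rewrite dist0 !mulr0.
  have c01 : 0 <= (0 : R) < 1 by apply/andP; split; [exact: lexx|exact: ltr01].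
  (* With c = 0 and L = 0 the variance bound is 0, and the right-hand side is nonnegative. *)
  apply: le_trans (emp_mean_var_le T T0 x polish moment c01 contr0 ratio (lexx 0) f0) _.
  rewrite mulr0 mul0r (expr0n R 2) mulr0 mul0r.
  have kT0 : 0 <= kappa * T.+1%:R by rewrite ltW ?mulr_gt0.
  have LkT0 : 0 <= lipnorm dist f ^+ 2 / (kappa * T.+1%:R) by rewrite divr_ge0 ?sqr_ge0.
  case: ifP => _; rewrite -EFinM lee_fin; apply: mulr_ge0 => //; apply: divr_ge0;
    rewrite ?(ltW kappa0) //.
  by rewrite mulr_ge0 ?addr_ge0 ?invr_ge0.
have c01 : 0 <= 1 - kappa < 1 by rewrite subr_ge0 kappa1 gtrBl.
apply: le_trans (emp_mean_var_le T T0 x polish moment c01 contr ratio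
  (lipnorm_ge0 f metric) fL) _.
have subKk : 1 - (1 - kappa) = kappa by ring.
(* For T0 = 0 the correction vanishes, leaving T (L / (kappa T))^2 with L the Lipschitz norm. *)
rewrite subKk; case: ifP => [/eqP ->|_]; rewrite -EFinM lee_fin ler_wpM2r //.
  rewrite expr0 expr1n subrr mul0r addr0 le_eqVlt; apply/orP; left; apply/eqP.
  by field; rewrite !gt_eqF.
(* Otherwise the correction is at most 1/kappa, and the claimed constant factors as (T + 1/kappa) (L
   / (kappa T))^2. *)
have -> : lipnorm dist f ^+ 2 / (kappa * T.+1%:R) * (1 + (kappa * T.+1%:R)^-1) / kappa
    = (T.+1%:R + 1 / kappa) * (T.+1%:R^-1 * lipnorm dist f / kappa) ^+ 2.
  by field; rewrite !gt_eqF.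
rewrite ler_wpM2r ?sqr_ge0 // lerD2l ler_wpM2r ?invr_ge0 ?(ltW kappa0) //.
by rewrite gerBl sqr_ge0.
Qed.
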